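(* Let $F$ be a field, $R=F[x_1,\dots,x_n]$, let $d\ge 2$ be an integer, and let $I\subset R$ be an equigenerated squarefree monomial ideal of degree $d$ with $\mathrm{supp}(I)=\{x_1,\dots,x_n\}$ and minimal set of monomial generators $G(I)=\{u_1,\dots,u_r\}$ (with $r=|G(I)|$). Let $(a_0,a_1,\dots,a_{d-1})\in\mathbb{Z}^d$. Then $I$ is a quasi $f$-ideal of type $(a_0,a_1,\dots,a_{d-1})$ if and only if the following three conditions all hold: (1) $\mathrm{ht}(I)=n-d$; (2) $\binom{n}{d}\equiv 0 \pmod 2$ if $a_{d-1}$ is even and $\binom{n}{d}\equiv 1\pmod 2$ if $a_{d-1}$ is odd, and $r=|G(I)|=\frac12\left(\binom{n}{d}-a_{d-1}\right)$; (3) for every $i=0,1,\dots,d-2$, $a_i$ is the number of $i$-dimensional non-faces of $\delta_{\mathcal F}(I)$.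
   Context: A squarefree monomial ideal is equigenerated of degree $d$ if all its minimal monomial generators have degree $d$. $\mathrm{supp}(I)$ is the set of variables dividing at least one element of $G(I)$, and $\mathrm{ht}(I)$ is the height of $I$. Let $V=\{v_1,\dots,v_n\}$ be a vertex set. The facet complex $\delta_{\mathcal F}(I)$ consists of all subsets of $V$ contained in one of the sets $F_j=\{v_k : x_k \text{ divides } u_j\}$, $u_j\in G(I)$. The non-face (Stanley-Reisner) complex $\delta_{\mathcal N}(I)$ consists of all subsets $\{v_{i_1},\dots,v_{i_k}\}\subseteq V$ (distinct vertices) such that $x_{i_1}\cdots x_{i_k}\notin I$. The dimension of a set $W\subseteq V$ is $|W|-1$, and the dimension of a simplicial complex is the maximum of the dimensions of its faces. For a simplicial complex $\Delta$, $f_i(\Delta)$ is the number of faces of dimension $i$ (equal to $0$ for $i>\dim\Delta$). An $i$-dimensional non-face of $\Delta$ is a subset of $V$ with $i+1$ elements that is not in $\Delta$. A squarefree monomial ideal $I$ is a quasi $f$-ideal of type $(a_0,a_1,\dots,a_s)\in\mathbb{Z}^{s+1}$ if $\dim\delta_{\mathcal F}(I)=\dim\delta_{\mathcal N}(I)=s$ and $f_i(\delta_{\mathcal N}(I))-f_i(\delta_{\mathcal F}(I))=a_i$ for all $0\le i\le s$. *)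

(* Defs.v *)
From HB Require Import structures.
From mathcomp Require Import all_boot all_order all_algebra.
From mathcomp Require Import finmap.
From mathcomp Require Import mpoly.

Set Implicit Arguments.
Unset Strict Implicit.
Unset Printing Implicit Defensive.

Import GRing.Theory.
Local Open Scope ring_scope.

Section Height.
Variable R : comNzRingType.

(* [prime_idealr R] is the type of (proper) prime ideals; a chain of length k
   is Q 0 < Q 1 < ... < Q k = P, the values of Q beyond k being irrelevant. *)
Definition prime_chain (P : prime_idealr R) (k : nat) : Prop :=
  exists Q : nat -> prime_idealr R,
    Q k =i P /\
    forall i, (i < k)%N ->
      {subset Q i <= Q i.+1} /\ ~ {subset Q i.+1 <= Q i}.

Definition prime_height (P : prime_idealr R) (h : nat) : Prop :=
  prime_chain P h /\ forall k, prime_chain P k -> (k <= h)%N.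

(* [height I h] : the minimum of the heights of the primes containing I is h.
   Primes of infinite height satisfy no [prime_height P k] and do not affect
   the minimum; the unit ideal has no (finite) height. *)
Definition height (I : {pred R}) (h : nat) : Prop :=
  (exists P : prime_idealr R, {subset I <= P} /\ prime_height P h) /\
  (forall (P : prime_idealr R) k,
     {subset I <= P} -> prime_height P k -> (h <= k)%N).

End Height.

Section MonomialIdeals.
Variables (n : nat) (F : fieldType).
Local Notation R := {mpoly F[n]}.

Definition generated_by (I : {pred R}) (G : {fset 'X_{1..n}}) : Prop :=
  forall p : R,
    p \in I <-> exists c : 'X_{1..n} -> R, p = \sum_(m <- G) c m * 'X_[m].

Definition minimal_generators (I : {pred R}) (G : {fset 'X_{1..n}}) : Prop :=
  generated_by I G /\
  forall H : {fset 'X_{1..n}}, (H `<` G)%fset -> ~ generated_by I H.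

(* The minimal set of monomial generators of a monomial ideal exists and is
   unique, so the second field is determined by the first. *)
Record monomial_ideal := MonomialIdeal {
  ideal_pred :> {pred R};
  gens : {fset 'X_{1..n}};
  gensP : minimal_generators ideal_pred gens
}.

Implicit Type I : monomial_ideal.

(* The indices of the variables dividing x^m. *)
Definition mvars (m : 'X_{1..n}) : {set 'I_n} := [set k | (0 < m k)%N].

Definition squarefree I : Prop :=
  forall m, m \in gens I -> forall k, (m k <= 1)%N.

Definition equigenerated I (d : nat) : Prop :=
  forall m, m \in gens I -> mdeg m = d.

Definition supp I : {set 'I_n} := \bigcup_(m <- gens I) mvars m.

Definition facet_complex I : {set {set 'I_n}} :=
  [set W : {set 'I_n} | has (fun m => W \subset mvars m) (gens I)].

Definition nonface_complex I : {set {set 'I_n}} :=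
  [set W : {set 'I_n} | \prod_(k in W) ('X_k : R) \notin I].

End MonomialIdeals.

Section Complexes.
Variable n : nat.
Implicit Types (W : {set 'I_n}) (D : {set {set 'I_n}}).

Definition sdim W : int := #|W|%:Z - 1.

(* The maximum of [sdim W] over the faces W; the void complex, which has no
   faces, gets dimension -1 like the complex {set0}. *)
Definition cdim D : int := (\max_(W in D) #|W|)%N%:Z - 1.

Definition fnum D (i : nat) : nat := #|[set W in D | sdim W == i%:Z]|.

Definition nonface_num D (i : nat) : nat :=
  #|[set W | (W \notin D) && (sdim W == i%:Z)]|.

End Complexes.

Definition quasi_f_ideal (n : nat) (F : fieldType) (I : monomial_ideal n F)
    (a : seq int) : Prop :=
  squarefree I /\
  exists s : nat,
    [/\ size a = s.+1,
        cdim (facet_complex I) = s%:Z,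
        cdim (nonface_complex I) = s%:Z
      & forall i, (i <= s)%N ->
          (fnum (nonface_complex I) i)%:Z - (fnum (facet_complex I) i)%:Z
          = a`_i].

(* Main.v *)
Require Import Defs.
From Stdlib Require Import Classical.
From HB Require Import structures.
From mathcomp Require Import all_boot all_order all_algebra.
From mathcomp Require Import finmap.
From mathcomp Require Import mpoly.
From mathcomp Require Import ring.

(** Write N for the non-face complex and D for the facet complex of I. The
    generators are squarefree of degree d, so m |-> mvars m identifies them
    with certain d-subsets of the n vertices; these are the facets of D, and a
    set W is in N iff it contains none of them ([nonfaceP]). Hence dim D = d-1,
    every set with fewer than d elements is in N, and a set with exactly d
    elements is in N iff it is not in D. Together with the count
    #(non-faces of dimension i) + f_i(D) = 'C(n, i+1) ([nonface_numD]) this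
    says that, for i < d-1, f_i(N) - f_i(D) is the number of i-dimensional
    non-faces of D, and that f_(d-1)(N) - f_(d-1)(D) = 'C(n, d) - 2r. So the
    prescribed differences amount to the condition on r, which entails the one
    on parity, and the conditions on the a_i with i < d-1; what remains of the
    definition is dim N = d-1.

    That last equality is the height condition, by ht(I) = n - max #|W| over W
    in N ([height_nonface]). A prime P containing I contains a variable of
    every generator, so the vertices whose variable is not in P form a face of
    N; conversely, if W is in N then I lies in the prime generated by the
    variables outside W. The formula therefore reduces to the fact that the
    prime generated by a set C of variables has height #|C|. Adjoining the
    variables of C one by one gives a chain of length #|C|. In the other
    direction, any chain ending at that prime extends by the remaining n - #|C|
    variables, so it is enough to know that F[x_1..x_n] has no prime chain of
    length n+1 ([mpoly_prime_chain_le]).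

    For this dimension bound, pick y_i in Q_(i+1) but not in Q_i along a chain
    of length n+1. The y_i are algebraically independent over F
    ([prime_chain_alg_indep]): in a relation, written as a polynomial in the
    element y chosen at the bottom of the chain, the constant coefficient lies
    in the next prime, so it vanishes by induction on the chain, after which y
    can be cancelled. But n+1 polynomials in n variables are always
    algebraically dependent ([alg_dependent]), by comparing the number of
    monomials in the y_i of bounded exponents with the number of monomials in
    the x_i that they involve. *)

Set Implicit Arguments.
Unset Strict Implicit.
Unset Printing Implicit Defensive.

Import GRing.Theory.
Local Open Scope ring_scope.

(** * The dimension of a polynomial ring *)

(** The inductive step of algebraic independence along a chain, read as a
    statement on one-variable polynomials. Modulo Q' the value p(y) is the
    constant coefficient, which therefore vanishes; as y is not in the prime Q,
    the remaining factor y can be cancelled, and the degree drops. *)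
Lemma prime_step_poly_eq0 (S R : comNzRingType) (g : {rmorphism S -> R})
    (Q Q' : prime_idealr R) (y : R) :
    {subset Q <= Q'} -> y \in Q' -> y \notin Q ->
    (forall s, g s \in Q' -> s = 0) ->
  forall p : {poly S}, (map_poly g p).[y] \in Q -> p = 0.
Proof.
move=> sQ yQ' yNQ inj; elim/poly_ind => [//|p c IH].
rewrite rmorphD rmorphM /= map_polyX map_polyC /= !hornerE => pQ.
have c0 : c = 0.
  apply: inj; rewrite -[g c](addKr ((map_poly g p).[y] * y)).
  by apply: rpredD; [rewrite rpredN; apply: idealMr | apply: sQ].
move: pQ; rewrite c0 rmorph0 addr0 prime_idealrM (negPf yNQ) orbF.
by move=> /IH ->; rewrite mul0r add0r.
Qed.

(** This reduces relations between k+1 elements to the one-variable step above,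
    applied with the evaluation at the first k elements as ring morphism. *)
Lemma mmap_muni (F : comNzRingType) (R : comNzRingType) (f : {rmorphism F -> R})
    (k : nat) (y : 'I_k.+1 -> R) (p : {mpoly F[k.+1]}) :
  mmap f y p =
  (map_poly (mmap f (fun i => y (widen_ord (leqnSn k) i))) (muni p))
    .[y ord_max].
Proof.
rewrite muniE rmorph_sum horner_sum; apply: eq_bigr => m _ /=.
rewrite map_polyZ /= map_polyXn !hornerE mmapZ mmapX /mmap1.
rewrite big_ord_recr /= mulrA.
by congr (_ * _ * _); apply: eq_bigr => i _; rewrite mnmE.
Qed.

Lemma muni_eq0 (F : comNzRingType) (k : nat) (p : {mpoly F[k.+1]}) :
  muni p = 0 -> p = 0.
Proof.
move=> p0; rewrite -[p]comp_mpoly_id /comp_mpoly mmap_muni p0.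
by rewrite rmorph0 horner0.
Qed.

(** The chain is indexed downwards because [muni] singles out the last variable,
    which must be the element chosen at the bottom of the chain. Working modulo
    Q k, and not just with exact relations, is what makes the induction go
    through. *)
Lemma prime_chain_alg_indep (F : fieldType) (R : comNzRingType)
    (f : {rmorphism F -> R}) (k : nat) (Q : nat -> prime_idealr R)
    (y : 'I_k -> R) :
    (forall i : 'I_k,
       [/\ {subset Q i.+1 <= Q i}, y i \in Q i & y i \notin Q i.+1]) ->
  forall p : {mpoly F[k]}, mmap f y p \in Q k -> p = 0.
Proof.
elim: k y => [|k IH] y Qy p.
  rewrite [p]nvar0_mpolyC mmapC => fpQ; apply/eqP; rewrite mpolyC_eq0.
  apply: contraTT fpQ => p0; apply/negP => /(idealMr (f (p@_0%MM)^-1)).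
  by rewrite -rmorphM mulVf // rmorph1 idealr1.
have [sQ yQ yNQ] := Qy ord_max.
rewrite mmap_muni => /(prime_step_poly_eq0 sQ yQ yNQ) /= pQ.
by apply/muni_eq0/pQ => q /IH; apply=> i; apply: (Qy (widen_ord _ i)).
Qed.

Lemma mpoly_eq0_bounded (F : nzRingType) (n b : nat) (p : {mpoly F[n]}) :
    (msize p <= b)%N ->
    (forall u : {ffun 'I_n -> 'I_b}, p@_[multinom val (u i) | i < n] = 0) ->
  p = 0.
Proof.
move=> pb p0; apply/mpolyP => m; rewrite mcoeff0.
apply/eqP; rewrite mcoeff_eq0; apply/negP => mp.
have mb i : (m i < b)%N.
  apply: leq_trans pb; apply: leq_trans (msize_mdeg_lt mp); rewrite ltnS.
  by rewrite mdegE (bigD1 i) //= leq_addr.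
have := p0 [ffun i => Ordinal (mb i)].
suff -> : [multinom val ([ffun i => Ordinal (mb i)] i) | i < n] = m.
  by apply/eqP; rewrite -mcoeff_msupp.
by apply/mnmP => i; rewrite mnmE ffunE.
Qed.

Lemma msizeM_leS (F : idomainType) (n a b : nat) (p q : {mpoly F[n]}) :
  (msize p <= a.+1 -> msize q <= b.+1 -> msize (p * q) <= (a + b).+1)%N.
Proof.
have [->|p0] := eqVneq p 0; first by rewrite mul0r msize0.
have [->|q0] := eqVneq q 0; first by rewrite mulr0 msize0.
rewrite msizeM // => pa qb; apply: leq_trans (_ : (a.+1 + b.+1).-1 <= _)%N.
  by rewrite -!subn1 leq_sub2r // leq_add.
by rewrite addnS.
Qed.

Lemma msizeX_leS (F : idomainType) (n a k : nat) (p : {mpoly F[n]}) :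
  (msize p <= a.+1 -> msize (p ^+ k) <= (k * a).+1)%N.
Proof.
move=> pa; elim: k => [|k IH]; first by rewrite expr0 -mpolyC1 msizeC leq_b1.
by rewrite exprS mulSn; apply: msizeM_leS.
Qed.

(** With all exponents of the y_i below D, there are D ^ (n+1) monomials in the
    y_i, and they have degree at most c * D for a constant c, hence lie in a
    space of dimension at most (c * D + 1) ^ n. For D large the former number
    is bigger, and a linear relation between these monomials is an algebraic
    relation between the y_i. *)
Lemma alg_dependent (F : fieldType) (n : nat) (y : 'I_n.+1 -> {mpoly F[n]}) :
  exists2 p : {mpoly F[n.+1]}, p != 0 & mmap (@mpolyC n F) y p = 0.
Proof.
(* D > c.+1 ^ n makes D ^ n.+1 exceed (c.+1 * D) ^ n, which bounds b ^ n. *)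
pose e := (\max_i msize (y i))%N; pose c := (n.+1 * e)%N.
pose D := (c.+1 ^ n).+1; pose b := (c * D).+1.
pose T := {ffun 'I_n.+1 -> 'I_D}; pose U := {ffun 'I_n -> 'I_b}.
pose mT (t : T) : 'X_{1..n.+1} := [multinom val (t i) | i < n.+1].
pose mU (u : U) : 'X_{1..n} := [multinom val (u i) | i < n].
(* The rows of A are the coefficients of the monomials in the y_i. *)
pose A := \matrix_(t < #|T|, u < #|U|)
  (mmap (@mpolyC n F) y 'X_[mT (enum_val t)])@_(mU (enum_val u)).
have cardUT : (#|U| < #|T|)%N.
  rewrite !card_ffun !card_ord.
  have leX x z k : (x <= z -> x ^ k <= z ^ k)%N.
    by move=> xz; elim: k => // k IH; rewrite !expnS leq_mul.
  have bD : (b <= c.+1 * D)%N by rewrite mulSn addSn ltnS leq_addl.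
  apply: (@leq_ltn_trans (c.+1 ^ n * D ^ n)); first by rewrite -expnMn leX.
  by rewrite expnS ltn_pmul2r // expn_gt0.
have /rowV0Pn [v /sub_kermxP vA v0] : kermx A != 0.
  rewrite kermx_eq0 /row_free; apply: contraTneq cardUT => <-.
  by rewrite -leqNgt rank_leq_col.
pose p := \sum_(t < #|T|) v 0 t *: 'X_[mT (enum_val t)].
have mT_inj : injective mT.
  move=> s t /mnmP st; apply/ffunP => i; apply: val_inj.
  by have := st i; rewrite !mnmE.
exists p.
  apply: contra_neq v0 => p0; apply/rowP => t.
  have := congr1 (mcoeff (mT (enum_val t))) p0.
  rewrite raddf_sum /= (bigD1 t) //= mcoeffZ mcoeffX eqxx mulr1 big1.
    by rewrite addr0 mcoeff0 mxE.
  move=> s st; rewrite mcoeffZ mcoeffX (inj_eq mT_inj) (inj_eq enum_val_inj).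
  by rewrite (negPf st) mulr0.
have mmapE0 : mmap (@mpolyC n F) y p =
    \sum_(t < #|T|) v 0 t *: mmap (@mpolyC n F) y 'X_[mT (enum_val t)].
  rewrite raddf_sum /=; apply: eq_bigr => t _.
  by rewrite mmapZ mul_mpolyC.
apply: (@mpoly_eq0_bounded _ _ b).
  rewrite mmapE0; apply: (leq_trans (msize_sum _ _ _)).
  apply/bigmax_leqP => t _; apply: leq_trans (msizeZ_le _ _) _.
  rewrite mmapX /mmap1.
  have : (msize (\prod_(i < n.+1) y i ^+ mT (enum_val t) i)
          <= (\sum_(i < n.+1) D * e).+1)%N.
    elim/big_ind2: _ => [|k p1 l p2 H1 H2|i _].
    - by rewrite -mpolyC1 msizeC leq_b1.
    - exact: msizeM_leS.
    apply: leq_trans (_ : (mT (enum_val t) i * e).+1 <= _)%N.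
      by apply: msizeX_leS; rewrite leqW // leq_bigmax.
    by rewrite ltnS leq_mul2r mnmE (ltnW (ltn_ord _)) orbT.
  by rewrite sum_nat_const card_ord /b /c -mulnA [(e * D)%N]mulnC.
move=> u; rewrite mmapE0 raddf_sum /=.
have := congr1 (fun M : 'rV_#|U| => M 0 (enum_rank u)) vA.
rewrite !mxE => {2}<-; apply: eq_bigr => t _.
by rewrite mcoeffZ mxE enum_rankK.
Qed.

(** The Krull dimension of F[x_1..x_n] is at most n: elements picked from the
    successive differences of a longer chain would be too many independent
    ones. *)
Lemma mpoly_prime_chain_le (F : fieldType) (n k : nat)
    (P : prime_idealr {mpoly F[n]}) :
  prime_chain P k -> (k <= n)%N.
Proof.
case=> Q [_ sQ]; rewrite leqNgt; apply/negP => ltnk.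
have lt_k (i : 'I_n.+1) : (n - i < k)%N.
  by rewrite (leq_ltn_trans _ ltnk) ?leq_subr.
have Qy (i : 'I_n.+1) : exists y : {mpoly F[n]},
    (y \in Q (n - i).+1) && (y \notin Q (n - i)%N).
  have [y] := not_all_ex_not _ _ (sQ _ (lt_k i)).2.
  case/(imply_to_and (_ \in _) (_ \in _)) => yQ /negP yNQ.
  by exists y; apply/andP.
have [p p0 py] := alg_dependent (fun i => xchoose (Qy i)).
case/eqP: p0.
pose Q' i := Q (n.+1 - i)%N.
have pQ : mmap (@mpolyC n F) (fun i => xchoose (Qy i)) p \in Q' n.+1.
  by rewrite py rpred0.
apply: prime_chain_alg_indep pQ => i; have /andP [] := xchooseP (Qy i).
rewrite /Q' subSS subSn -1?ltnS //; split=> //.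
exact: (sQ _ (lt_k i)).1.
Qed.

(** * Primes generated by variables *)

Section MonomialPrimes.
Variables (n : nat) (F : fieldType).
Local Notation R := {mpoly F[n]}.
Implicit Types (C D : {set 'I_n}) (p : R).

Definition kill_vars C : R -> R :=
  mmap (@mpolyC n F) (fun i => if i \in C then 0 else 'X_i).

HB.instance Definition _ C := GRing.RMorphism.on (kill_vars C).

Lemma kill_varsX C (m : 'X_{1..n}) :
  kill_vars C 'X_[m] = if [disjoint mvars m & C] then 'X_[m] else 0.
Proof.
rewrite /kill_vars mmapX /mmap1; case: ifP => [mC | /negbT].
  rewrite [RHS]mpolyXE_id; apply: eq_bigr => i _.
  case: ifP => // iC; have /pred0P /(_ i) := mC; rewrite /= inE iC andbT lt0n.
  by move/negbFE/eqP=> ->; rewrite !expr0.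
case/pred0Pn => i /andP [/=]; rewrite inE => mi iC.
by rewrite (bigD1 i) //= iC expr0n gtn_eqF // mul0r.
Qed.

Lemma kill_varsXU C i : kill_vars C 'X_i = if i \in C then 0 else 'X_i.
Proof. by rewrite /kill_vars mmapX mmap1U. Qed.

(** The ideal generated by the variables in C ([var_prime_min]). As the kernel
    of an evaluation it is prime, with a decidable membership. *)
Definition var_prime C : R -> bool := fun p => kill_vars C p == 0.

Lemma var_prime_idealr C : idealr_closed (var_prime C).
Proof.
split; rewrite ?inE /in_mem /= /var_prime ?rmorph0 ?rmorph1 ?oner_eq0 //.
move=> a u v /eqP u0 /eqP v0.
by rewrite /in_mem /= rmorphD rmorphM /= u0 v0 mulr0 addr0.
Qed.

Lemma var_prime_prime C : prime_idealr_closed (var_prime C).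
Proof. by move=> u v; rewrite /in_mem /= /var_prime rmorphM mulf_eq0. Qed.

HB.instance Definition _ C :=
  isIdealr.Build R (var_prime C) (var_prime_idealr C).
HB.instance Definition _ C :=
  isPrimeIdealrClosed.Build R (var_prime C) (@var_prime_prime C).

Lemma var_primeX C (m : 'X_{1..n}) :
  ('X_[m] \in var_prime C) = ~~ [disjoint mvars m & C].
Proof.
rewrite /in_mem /= /var_prime kill_varsX; case: ifP; rewrite ?eqxx //.
by rewrite -msupp_eq0 msuppX.
Qed.

Lemma var_primeXU C i : ('X_i \in var_prime C) = (i \in C).
Proof.
rewrite /in_mem /= /var_prime kill_varsXU; case: ifP; rewrite ?eqxx //.
by rewrite -msupp_eq0 msuppX.
Qed.

(** A monomial minus its image under [kill_vars] is either 0 or a monomial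
    divisible by a variable in C. *)
Lemma var_prime_min C (P : prime_idealr R) :
  {in C, forall i, 'X_i \in P} -> {subset var_prime C <= P}.
Proof.
move=> CP p; rewrite {1}/in_mem /= /var_prime => /eqP p0.
have -> : p = \sum_(m <- msupp p) (p@_m)%:MP * ('X_[m] - kill_vars C 'X_[m]).
  rewrite -[LHS]subr0 -[X in _ - X = _]p0.
  rewrite [X in X - _]mpolyE [X in kill_vars C X]mpolyE.
  rewrite [kill_vars C _]raddf_sum /= -sumrB; apply: eq_bigr => m _.
  by rewrite -mul_mpolyC rmorphM /= {1}/kill_vars mmapC mulrBr.
apply: rpred_sum => m _; apply: idealMr; rewrite kill_varsX.
case: ifP; first by rewrite subrr rpred0.
move=> /negbT /pred0Pn [i /andP [/=]]; rewrite inE => mi iC.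
rewrite subr0 -(submK (m := U_(i)) (m' := m)) ?lep1mP -?lt0n //.
by rewrite mpolyXD idealMr // CP.
Qed.

(** The primes generated by the first j variables of C form a chain below P; its
    last term is replaced by P, which may be bigger. *)
Lemma prime_chain_height_ge (P : prime_idealr R) C :
  {in C, forall i, 'X_i \in P} -> prime_chain P #|C|.
Proof.
move=> CP; pose e := enum C.
pose Q j : prime_idealr R :=
  if (j < #|C|)%N then (var_prime [set i in take j e] : prime_idealr R)
  else P.
exists Q; split=> [p|j jC]; first by rewrite /Q ltnn.
have QX k i : i \in take k e -> 'X_i \in Q k.
  move=> ie; rewrite /Q; case: ifP => _; first by rewrite var_primeXU inE.
  by apply: CP; rewrite -mem_enum (mem_take ie).
have [i0 _] : exists i, i \in C by apply/card_gt0P/(leq_ltn_trans _ jC).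
have eS : take j.+1 e = rcons (take j e) (nth i0 e j).
  by rewrite -take_nth // -cardE.
split; first rewrite {1}/Q jC.
  apply: var_prime_min => i; rewrite inE => ie.
  by apply: QX; rewrite eS mem_rcons inE ie orbT.
move=> /(_ 'X_(nth i0 e j)); rewrite QX; last first.
  by rewrite eS mem_rcons mem_head.
rewrite /Q jC var_primeXU inE => /(_ isT).
have := take_uniq j.+1 (enum_uniq C).
by rewrite -/e eS rcons_uniq => /andP [/negPf ->].
Qed.

Lemma prime_chain_step (S : comNzRingType) (P P' : prime_idealr S) k :
    {subset P <= P'} -> ~ {subset P' <= P} ->
  prime_chain P k -> prime_chain P' k.+1.
Proof.
move=> sP nsP [Q [QP sQ]].
exists (fun i => if (i <= k)%N then Q i else P'); split=> [p|i].
  by rewrite ltnn.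
rewrite ltnS => ik; rewrite ik; case: ltngtP (ik) => // [ltik|->] _.
  exact: sQ.
split=> [p|sPQ]; first by rewrite QP; apply: sP.
by apply: nsP => p /sPQ; rewrite QP.
Qed.

(** A chain longer than #|C| would extend, by adjoining the variables outside C,
    to a chain longer than n. *)
Lemma var_prime_height C : prime_height (var_prime C) #|C|.
Proof.
split; first by apply: prime_chain_height_ge => i; rewrite var_primeXU.
move=> k Ck.
suff H : prime_chain (var_prime [set: 'I_n]) (k + #|~: C|).
  have := mpoly_prime_chain_le H.
  by rewrite -[n in (_ <= n)%N]card_ord -(cardsC C) leq_add2r.
move: {-1}_.+1 (ltnSn #|~: C|) => N; elim: N C k Ck => // N IH C k Ck.
rewrite ltnS; have [/eqP|[i iC]] := set_0Vmem (~: C).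
  by move=> C0; rewrite (eqP C0) cards0 addn0 -[setT]setC0 -(eqP C0) setCK.
rewrite (cardsD1 i) iC add1n => CN.
have iCE : ~: C :\ i = ~: (i |: C) by rewrite setDE setCU setIC.
rewrite addnS -addSn iCE; apply: IH; last by rewrite -iCE.
apply: prime_chain_step Ck.
  by apply: var_prime_min => j jC; rewrite var_primeXU inE jC orbT.
move=> /(_ 'X_i); rewrite !var_primeXU setU11 => /(_ isT) iC'.
by rewrite inE iC' in iC.
Qed.

End MonomialPrimes.

(** * The height of a squarefree monomial ideal *)

Lemma height_uniq (S : comNzRingType) (J : {pred S}) h k :
  height J h -> height J k -> h = k.
Proof.
move=> [[P [JP Ph]] hmin] [[P' [JP' Pk]] kmin].
by apply/anti_leq; rewrite (hmin _ _ JP' Pk) (kmin _ _ JP Ph).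
Qed.

Section SquarefreeIdeals.
Variables (n : nat) (F : fieldType) (I : monomial_ideal n F).
Local Notation R := {mpoly F[n]}.
Implicit Types (W C : {set 'I_n}) (P : prime_idealr R).

Lemma gen_in_ideal (m : 'X_{1..n}) (p : R) : m \in gens I -> p * 'X_[m] \in I.
Proof.
move=> mI; apply/(gensP I).1; exists (fun m' => if m' == m then p else 0).
rewrite (big_fsetD1 m) //= eqxx big1_fset ?addr0 // => m'.
by rewrite in_fsetD1 => /andP [/negPf -> _] _; rewrite mul0r.
Qed.

Lemma ideal_sub_prime P :
  {subset I <= P} <-> (forall m, m \in gens I -> 'X_[m] \in P).
Proof.
split=> [IP m mI|GP p /((gensP I).1 p) [c ->]].
  by apply: IP; rewrite -['X_[m]]mul1r gen_in_ideal.
by rewrite big_seq; apply: rpred_sum => m mI; apply/idealMr/GP.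
Qed.

Lemma sub_var_primeC W :
    (forall m, m \in gens I -> ~~ (mvars m \subset W)) ->
  {subset I <= var_prime (F := F) (~: W)}.
Proof.
move=> WG; apply/ideal_sub_prime => m mI.
by rewrite var_primeX disjoints_subset setCK WG.
Qed.

Lemma mpolyX_prime P (m : 'X_{1..n}) :
  ('X_[m] \in P) = [exists i in mvars m, ('X_i : R) \in P].
Proof.
apply/idP/existsP => [|[i /andP [mi iP]]]; last first.
  rewrite inE in mi; rewrite -(submK (m := U_(i)) (m' := m)) ?lep1mP -?lt0n //.
  by rewrite mpolyXD idealMr.
rewrite [('X_[m] : R)]mpolyXE_id => mP; apply/existsP; apply: contraLR mP.
rewrite negb_exists => /forallP H.
elim/big_rec: _ => [|i x _ xP]; first by rewrite idealr1.
rewrite prime_idealrM negb_or xP andbT.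
have := H i; rewrite inE negb_and -eqn0Ngt.
case/orP => [/eqP ->|iP]; first by rewrite expr0 idealr1.
elim: (m i) => [|k IH]; first by rewrite expr0 idealr1.
by rewrite exprS prime_idealrM negb_or iP.
Qed.

Lemma prod_vars W : \prod_(k in W) ('X_k : R) = 'X_[mesym1 W].
Proof.
rewrite mpolyXE_id [LHS]big_mkcond; apply: eq_bigr => i _.
by rewrite mnmE; case: (i \in W); rewrite ?expr1 ?expr0.
Qed.

Hypothesis sqI : squarefree I.

(** If W contains no generator, then the prime of the variables outside W
    contains I but not the product of the variables in W. *)
Lemma nonfaceP W :
  reflect (forall m, m \in gens I -> ~~ (mvars m \subset W))
          (W \in nonface_complex I).
Proof.
rewrite inE prod_vars; apply: (iffP idP) => [WI m mI|WG].
  apply: contra WI => mW; rewrite -(submK (m := m) (m' := mesym1 W)).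
    by rewrite mpolyXD gen_in_ideal.
  apply/mnm_lepP => i; rewrite mnmE; have := sqI mI i.
  have [/(subsetP mW) -> //|] := boolP (i \in mvars m).
  by rewrite inE -eqn0Ngt => /eqP ->.
apply/negP => /(sub_var_primeC WG); rewrite var_primeX => /negP; apply.
rewrite disjoints_subset setCK; apply/subsetP => i.
by rewrite !inE mnmE lt0b.
Qed.

(** P contains a variable of each generator, so no generator is supported on the
    variables missing from P. *)
Lemma prime_sup_nonface P :
  {subset I <= P} -> [set i | ('X_i : R) \notin P] \in nonface_complex I.
Proof.
move=> /ideal_sub_prime IP; apply/nonfaceP => m /IP.
rewrite mpolyX_prime => /existsP [i /andP [mi iP]].
by apply/subsetPn; exists i => //; rewrite inE iP.
Qed.

(** A largest W gives a prime of height n - #|W| containing I. A prime of finite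
    height k containing I contains the variables outside some W, and has
    height at least their number. The case of the unit ideal is excluded by
    asking that 1 is not a generator. *)
Lemma height_nonface (h : nat) :
    0%MM \notin gens I ->
  height I h <-> (h + \max_(W in nonface_complex I) #|W|)%N = n.
Proof.
move=> I1; set a := (\max_(W in _) _)%N.
have N0 : set0 \in nonface_complex I.
  apply/nonfaceP => m mI; apply: contra I1 => /subsetP m0.
  suff <- : m = 0%MM by [].
  apply/mnmP => i; rewrite mnm0E; apply/eqP; rewrite eqn0Ngt.
  by apply/negP => mi; have := m0 i; rewrite !inE mi => /(_ isT).
have [W WN Wa] : {W | W \in nonface_complex I & a = #|W|}.
  by apply: eq_bigmax_cond; apply/card_gt0P; exists set0.
have cardn : (#|~: W| + a)%N = n by rewrite Wa addnC cardsC card_ord.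
have height_a : height I #|~: W|.
  split=> [|P k IP Pk].
    exists (var_prime (~: W)); split; first exact/sub_var_primeC/nonfaceP.
    exact: var_prime_height.
  set U := [set i | ('X_i : R) \notin P].
  have Ua : (#|U| <= a)%N by apply: leq_bigmax_cond (prime_sup_nonface IP).
  have UP : {in ~: U, forall i, ('X_i : R) \in P}.
    by move=> i; rewrite !inE negbK.
  apply: leq_trans (Pk.2 _ (prime_chain_height_ge UP)).
  rewrite -(leq_add2r a) cardn -[n in (n <= _)%N]card_ord -(cardsC U).
  by rewrite addnC leq_add2l.
split=> [hh|ha]; first by rewrite (height_uniq hh height_a) cardn.
by have -> : h = #|~: W| by apply: (@addIn a); rewrite cardn.
Qed.

End SquarefreeIdeals.

(** * Face numbers *)

Lemma sdim_eq (n i : nat) (W : {set 'I_n}) : (sdim W == i%:Z) = (#|W| == i.+1).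
Proof. by rewrite /sdim subr_eq -PoszD addn1. Qed.

Lemma nonface_numD (n i : nat) (D : {set {set 'I_n}}) :
  (nonface_num D i + fnum D i = 'C(n, i.+1))%N.
Proof.
rewrite -[n in 'C(n, _)]card_ord -card_draws addnC -(cardsID D).
congr (_ + _)%N; apply: eq_card => W; rewrite !inE sdim_eq //.
by rewrite andbC.
Qed.

Section Equigenerated.
Variables (n d : nat) (F : fieldType) (I : monomial_ideal n F).
Hypotheses (sqI : squarefree I) (degI : equigenerated I d).
Implicit Type W : {set 'I_n}.

Lemma mvarsK m : m \in gens I -> mesym1 (mvars m) = m.
Proof.
move=> mI; apply/mnmP => i; rewrite mnmE inE.
by have := sqI mI i; case: (m i) => [|[|]].
Qed.

Lemma card_mvars m : m \in gens I -> #|mvars m| = d.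
Proof. by move=> mI; rewrite -mdeg_mesym1 mvarsK // degI. Qed.

Lemma facetP W :
  reflect (exists2 m, m \in gens I & W \subset mvars m) (W \in facet_complex I).
Proof. by rewrite inE; apply: hasP. Qed.

Lemma cdim_facet (m : 'X_{1..n}) :
  m \in gens I -> cdim (facet_complex I) = d%:Z - 1.
Proof.
move=> mI; rewrite /cdim; congr (Posz _ - 1); apply/anti_leq/andP; split.
  apply/bigmax_leqP => W /facetP [m' m'I /subset_leq_card].
  by rewrite card_mvars.
rewrite -(card_mvars mI).
apply: (leq_bigmax_cond (F := fun W : {set _} => #|W|)).
by apply/facetP; exists m.
Qed.

Lemma nonface_lt W : (#|W| < d)%N -> W \in nonface_complex I.
Proof.
move=> Wd; apply/(nonfaceP sqI) => m mI; apply: contraL Wd => /subset_leq_card.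
by rewrite card_mvars // -leqNgt.
Qed.

(** Sets of size d contain a generator only by being equal to it, and likewise
    for being contained in one. *)
Lemma nonface_facet W : #|W| = d ->
  (W \in nonface_complex I) = (W \notin facet_complex I).
Proof.
move=> Wd; apply/(nonfaceP sqI)/negP => [WG /facetP [m mI Wm]|WF m mI].
  have /eqP WE : W == mvars m by rewrite eqEcard Wm card_mvars ?Wd /=.
  by have := WG m mI; rewrite WE subxx.
apply/negP => mW; apply: WF; apply/facetP; exists m => //.
have /eqP <- : mvars m == W by rewrite eqEcard mW card_mvars ?Wd /=.
exact: subxx.
Qed.

Lemma fnum_nonface_lt i : (i.+1 < d)%N ->
  fnum (nonface_complex I) i = 'C(n, i.+1).
Proof.
move=> id_; rewrite -[n in 'C(n, _)]card_ord -card_draws.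
apply: eq_card => W; rewrite [LHS]inE [RHS]inE sdim_eq andb_idl // => /eqP Wi.
by apply: nonface_lt; rewrite Wi.
Qed.

Lemma fnum_nonface_top i : d = i.+1 ->
  fnum (nonface_complex I) i = nonface_num (facet_complex I) i.
Proof.
move=> di; apply: eq_card => W; rewrite [LHS]inE [RHS]inE sdim_eq -di.
by have [Wd|] := eqVneq #|W| d; rewrite ?andbF // nonface_facet.
Qed.

(** [mvars] is injective on squarefree monomials. *)
Lemma fnum_facet_top i : d = i.+1 -> fnum (facet_complex I) i = #|` gens I|.
Proof.
move=> di; rewrite -(size_map (@mvars n)).
have /card_uniqP <- : uniq (map (@mvars n) (gens I)).
  rewrite map_inj_in_uniq ?fset_uniq // => m m' mI m'I mm'.
  by rewrite -(mvarsK mI) mm' mvarsK.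
apply: eq_card => W; rewrite [LHS]inE sdim_eq -di.
apply/andP/mapP => [[/facetP [m mI Wm] /eqP Wd]|[m mI ->]].
  by exists m => //; apply/eqP; rewrite eqEcard Wm card_mvars ?Wd /=.
by rewrite card_mvars // eqxx; split=> //; apply/facetP; exists m.
Qed.

End Equigenerated.

Lemma half_difference_rat (r c : nat) (a : int) :
  r%:R = (c%:R - a%:~R) / 2%:R :> rat <-> c%:Z - r%:Z - r%:Z = a.
Proof.
split=> [H|<-].
  have : (c%:Z - r%:Z - r%:Z)%:~R = a%:~R :> rat.
    by rewrite !intrB -!pmulrn H; field.
  by move/eqP; rewrite eqr_int => /eqP.
by rewrite !intrB -!pmulrn; field.
Qed.

Lemma parity_of_difference (r c : nat) (a : int) :
  c%:Z - r%:Z - r%:Z = a -> (2 %| a)%Z = ~~ odd c.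
Proof.
move=> <-; rewrite -addrA -opprD -mulr2n -[r%:Z *+ 2]mulr_natr.
by rewrite rpredBr ?dvdz_mull // dvdzE /= dvdn2.
Qed.

(** * Characterization of quasi f-ideals *)

Theorem theorem3p2 (F : fieldType) (n d : nat) (I : monomial_ideal n F)
    (a : d.-tuple int) :
  (2 <= d)%N ->
  squarefree I ->
  equigenerated I d ->
  supp I = [set: 'I_n] ->
  quasi_f_ideal I a <->
  [/\
      exists h : nat, height I h /\ h%:Z = n%:Z - d%:Z,
      [/\ (2 %| a`_(d.-1))%Z -> 'C(n, d) = 0 %[mod 2],
          ~~ (2 %| a`_(d.-1))%Z -> 'C(n, d) = 1 %[mod 2]
        & (#|` gens I|)%:R = ('C(n, d)%:R - (a`_(d.-1))%:~R) / 2%:R :> rat]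
    & forall i : nat, (i <= d - 2)%N ->
        a`_i = (nonface_num (facet_complex I) i)%:Z].
Proof.
move=> d2 sqI degI suppI.
have [e de] : exists e, d = e.+2 by exists d.-2; case: (d) d2 => [|[]].
have I1 : 0%MM \notin gens I.
  by apply/negP => /degI; rewrite mdeg0 de.
have top_eq : (fnum (nonface_complex I) e.+1)%:Z
    - (fnum (facet_complex I) e.+1)%:Z = a`_d.-1 <->
  'C(n, d)%:Z - #|` gens I|%:Z - #|` gens I|%:Z = a`_d.-1.
  rewrite (fnum_nonface_top sqI degI de) -(fnum_facet_top sqI degI de).
  have := nonface_numD e.+1 (facet_complex I); rewrite -de => <-.
  by rewrite PoszD addrK.
have low_eq i : (i <= e)%N ->
    (fnum (nonface_complex I) i)%:Z - (fnum (facet_complex I) i)%:Z =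
    (nonface_num (facet_complex I) i)%:Z.
  move=> ie; rewrite (fnum_nonface_lt sqI degI) ?de //.
  by have <- := nonface_numD i (facet_complex I); rewrite PoszD addrK.
have e_eq : (d - 2)%N = e by rewrite de subn2.
have e1_eq : e.+1 = d.-1 by rewrite de.
split=> [[_ [s [sa dimF dimN aE]]]|].
  have se : s = e.+1 by apply: succn_inj; rewrite -sa size_tuple.
  subst s.
  have := aE e.+1 (leqnn _); rewrite [in RHS]e1_eq => /top_eq aT.
  have par := parity_of_difference aT.
  split.
  - pose al := (\max_(W in nonface_complex I) #|W|)%N.
    have alE : al = d.
      move: dimN; rewrite /cdim -/al => /eqP.
      by rewrite subr_eq -PoszD addn1 -de => /eqP [].
    have aln : (al <= n)%N.
      by apply/bigmax_leqP => W _; rewrite -[n in (_ <= n)%N]card_ord max_card.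
    exists (n - al)%N; split; last by rewrite -alE subzn.
    by apply/(height_nonface sqI) => //; rewrite subnK.
  - rewrite par negbK !modn2; split=> [/negPf ->|->|] //.
    exact/half_difference_rat.
  by move=> i; rewrite e_eq => ie; rewrite -aE ?low_eq // leqW.
move=> [[h [hI hE]] [_ _ /half_difference_rat aT] aE].
have aln : (\max_(W in nonface_complex I) #|W|)%N = d.
  have := (height_nonface sqI h I1).1 hI => hn.
  apply: (@addnI h); rewrite hn; apply/eqP.
  by rewrite -eqz_nat PoszD hE subrK.
(* A generator exists because n >= d > 0 and the support is everything. *)
have [m mI] : exists m, m \in gens I.
  have [I0|[m mI]] := fset_0Vmem (gens I); last by exists m.
  have : (0 < n)%N.
    apply: leq_trans (_ : (d <= n)%N); first by rewrite de.
    by rewrite -((height_nonface sqI h I1).1 hI) aln leq_addl.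
  move=> n0; have := in_setT (Ordinal n0).
  by rewrite -suppI /supp I0 big_seq_fset0 inE.
split=> //; exists e.+1; split.
- by rewrite size_tuple.
- by rewrite (cdim_facet sqI degI mI) de -addn1 PoszD addrK.
- by rewrite /cdim aln de -addn1 PoszD addrK.
move=> i; rewrite leq_eqVlt => /predU1P [->|].
  by rewrite [in RHS]e1_eq; apply/top_eq.
by rewrite ltnS => ie; rewrite low_eq // aE ?e_eq.
Qed.
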